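(* For any integer $n \geq 2$ and any real number $r\geq 0$, \[ \kappa_H(n, r) \geq \frac{2\, B\left( \frac{n-1}{2}, \frac{1}{2} \right)}{B\left(\operatorname{sech}^2 r - \frac{\operatorname{sech}^4 r}{4}; \frac{n-1}{2}, \frac{1}{2} \right)}. \]
   Context: $\mathbb{H}^n$ denotes $n$-dimensional hyperbolic space. A sphere of radius $r$ in $\mathbb{H}^n$ is the set of points at geodesic distance $r$ from a point (its centre). The kissing number $\kappa_H(n,r)$ is the maximal number of spheres of radius $r$ in $\mathbb{H}^n$, with pairwise disjoint interiors, that simultaneously touch a fixed central sphere of radius $r$. $B(x; y, z) = \int_0^x t^{y-1}(1-t)^{z-1}\,dt$ is the incomplete beta-function for $x \in [0,1]$, $y,z>0$, and $B(y,z) = B(1;y,z)$. *)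

(* Defs.v *)
From HB Require Import structures.
From mathcomp Require Import all_boot all_order all_algebra.
From mathcomp Require Import all_classical all_reals all_analysis.

Set Implicit Arguments.
Unset Strict Implicit.
Unset Printing Implicit Defensive.

Import Order.TTheory GRing.Theory Num.Theory.
Import numFieldNormedType.Exports.

Local Open Scope classical_set_scope.
Local Open Scope ring_scope.

Section HyperbolicFunctions.
Context {R : realType}.

Definition cosh (x : R) : R := (expR x + expR (- x)) / 2.

Definition sech (x : R) : R := (cosh x)^-1.

(* Used only for 1 <= u, where it is the nonnegative inverse of cosh. *)
Definition arcosh (u : R) : R := ln (u + Num.sqrt (u ^+ 2 - 1)).

End HyperbolicFunctions.

(* B(x; y, z). The integrand may blow up at 0 and 1; the Lebesgue integral    *)
(* covers the improper case, since endpoints have measure zero.               *)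
Definition incomplete_beta {R : realType} (x y z : R) : R :=
  \int[lebesgue_measure]_(t in `[0, x])
    (t `^ (y - 1) * (1 - t) `^ (z - 1)).

Definition beta {R : realType} (y z : R) : R := incomplete_beta 1 y z.

Section HyperbolicSpace.
Context {R : realType} {n : nat}.

(* Coordinate 0 is the time coordinate: -x_0 y_0 + x_1 y_1 + ... + x_n y_n.   *)
Definition lorentz (x y : 'rV[R]_n.+1) : R :=
  \sum_(i < n) x 0 (lift ord0 i) * y 0 (lift ord0 i) - x 0 ord0 * y 0 ord0.

(* Hyperboloid model of H^n: the upper sheet of <x, x> = -1.                  *)
Definition hyperbolic_space : Type :=
  {x : 'rV[R]_n.+1 | (lorentz x x == -1) && (0 < x 0 ord0)}.

(* In this model the geodesic distance satisfies cosh d(p, q) = - <p, q>.     *)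
Definition hdist (p q : hyperbolic_space) : R :=
  arcosh (- lorentz (val p) (val q)).

Definition hsphere (c : hyperbolic_space) (r : R) : set hyperbolic_space :=
  [set p | hdist c p = r].

(* The interior of the sphere of centre c and radius r.                       *)
Definition hball (c : hyperbolic_space) (r : R) : set hyperbolic_space :=
  [set p | hdist c p < r].

(* The spheres of radius r centred at c and c' are externally tangent.        *)
Definition touch (r : R) (c c' : hyperbolic_space) : Prop :=
  hsphere c r `&` hsphere c' r !=set0 /\ hball c r `&` hball c' r = set0.

Definition kissing_configuration (r : R) (o : hyperbolic_space) (N : nat)
    (c : 'I_N -> hyperbolic_space) : Prop :=
  (forall i, touch r o (c i)) /\
  (forall i j, i != j -> hball (c i) r `&` hball (c j) r = set0).

End HyperbolicSpace.

Arguments hyperbolic_space R n : clear implicits.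

(* kappa_H(n, r), as a supremum in the extended reals. Spheres are counted as *)
(* indexed families; for r > 0 members with disjoint interiors are distinct,  *)
(* so this is the usual count. For r = 0 spheres are points with empty        *)
(* interior, any number of which touch, and the value is +oo. By homogeneity  *)
(* of H^n the choice of the centre o is immaterial.                           *)
Definition kissing_number {R : realType} (n : nat) (r : R) : \bar R :=
  ereal_sup [set N%:R%:E | N in
    [set N : nat | exists (o : hyperbolic_space R n)
                          (c : 'I_N -> hyperbolic_space R n),
                     kissing_configuration r o c]].

(* Main.v *)
(* Centres at distance 2r from o, in directions forming pairwise angles at least
   a, where cos a = 1 - sech^2 r / 2, give a kissing configuration. A maximal
   family of N such directions covers the unit sphere by caps of angular radius a,
   so N times the normalised measure of a cap is at least 1.
   The measure of the sphere is replaced by a positive functional on sums of even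
   powers of linear forms, given by its explicit moments. Its positivity is proved
   by induction on the dimension, slicing the sphere by its first coordinate: the
   induction step integrates a nonnegative polynomial against a beta weight. The
   indicator function of the double cap |<x, v>| >= cos a, by which every point is
   covered twice, is approximated by polynomials in <x, v>^2. *)
Require Import Defs.
From mathcomp Require Import all_boot all_order all_algebra.
From mathcomp Require Import all_classical all_reals all_analysis.
From mathcomp Require Import measurable_realfun ring lra.

Set Implicit Arguments.
Unset Strict Implicit.
Unset Printing Implicit Defensive.

Import Order.TTheory GRing.Theory Num.Theory.
Import numFieldNormedType.Exports.

Local Open Scope classical_set_scope.
Local Open Scope ring_scope.

(** * Beta integrals *)

Section Truncation.
Context {R : realType}.
Notation mu := (@lebesgue_measure R).
Implicit Types f F : R -> R.

(** The shift by 3 keeps the value below 1/2 for every n, so the truncated interval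
    [[cut_end n, 1 - cut_end n]] is never degenerate. *)
Definition cut_end (n : nat) : R := n.+3%:R^-1.

Lemma cut_end_gt0 n : 0 < cut_end n.
Proof. by rewrite invr_gt0. Qed.

Lemma cut_end_lt_half n : cut_end n < 1 - cut_end n.
Proof.
rewrite /cut_end.
have : (n.+3%:R : R)^-1 <= 3%:R^-1 by rewrite lef_pV2 ?posrE// ler_nat.
by move: (n.+3%:R^-1) => h; lra.
Qed.

Lemma cut_FTC f F n :
  {in `]0, 1[%R, continuous f} ->
  (forall x : R, x \in `]0, 1[%R -> is_derive x 1 F (f x)) ->
  (\int[mu]_(x in `[cut_end n, (1 - cut_end n)%R]) (f x)%:E =
    (F (1 - cut_end n)%R - F (cut_end n))%:E)%E.
Proof.
move=> cf dF.
set h := cut_end n.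
have h0 : 0 < h by exact: cut_end_gt0.
have h1 : h < 1 - h := cut_end_lt_half n.
have sub x : x \in `[h, 1 - h] -> x \in `]0, 1[%R.
  rewrite !in_itv/= => /andP[? ?]; apply/andP; split; lra.
have cF x : x \in `]0, 1[%R -> {for x, continuous F}.
  by move=> x01; apply: differentiable_continuous; apply/derivable1_diffP;
     have [] := dF _ x01.
rewrite (@continuous_FTC2 _ f F)//.
- apply: continuous_in_subspaceT => x; rewrite inE/= => /sub; exact: cf.
- split.
  + by move=> x /subset_itv_oo_cc /sub x01; have [] := dF _ x01.
  + apply: cvg_at_right_filter; apply: cF; apply: sub.
    by rewrite in_itv/= lexx ltW.
  + apply: cvg_at_left_filter; apply: cF; apply: sub.
    by rewrite in_itv/= lexx ltW.
- move=> x /subset_itv_oo_cc /sub x01; rewrite derive1E.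
  by have [_] := dF _ x01.
Qed.

Lemma cut_nondecreasing :
  nondecreasing_seq (fun n => `[cut_end n, 1 - cut_end n]%classic : set R).
Proof.
apply/nondecreasing_seqP => n; rewrite subsetEset => x /=.
have : (cut_end n.+1 : R) <= cut_end n.
  by rewrite /cut_end lef_pV2 ?posrE// ler_nat.
rewrite !in_itv/=; move: (cut_end n.+1 : R) (cut_end n : R) => a b ab.
by move=> /andP[? ?]; apply/andP; split; lra.
Qed.

Lemma bigcup_cut :
  \bigcup_n (`[cut_end n, 1 - cut_end n]%classic : set R) = `]0, 1[%classic.
Proof.
apply/seteqP; split => x /=.
  move=> [n _] /=; have := cut_end_gt0 n; have := cut_end_lt_half n.
  rewrite !in_itv/=; move: (cut_end n : R) => a ? ? /andP[? ?].
  by apply/andP; split; lra.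
rewrite in_itv/= => /andP[x0 x1].
have m0 : 0 < Num.min x (1 - x) by rewrite lt_min x0 subr_gt0.
have /cvgrPdist_lt/(_ _ m0)[N _ hN] := @cvg_harmonic R.
exists N => //=.
(* The harmonic sequence is 1/(n + 1), so its term at N + 2 is [cut_end N]. *)
have /= := hN N.+2 (leq_trans (leqnSn _) (leqnSn _)); rewrite -/(cut_end N).
rewrite sub0r normrN gtr0_norm ?cut_end_gt0// lt_min => /andP[].
rewrite in_itv/=; move: (cut_end N : R) => a ? ?.
by apply/andP; split; lra.
Qed.

(** By monotone convergence the integral is the limit of the truncated integrals, each a difference
    of two values of F and so at most 2M. *)
Lemma ge0_integrable_FTC f F (M : R) :
  measurable_fun setT f -> (forall x, 0 <= f x) ->
  {in `]0, 1[%R, continuous f} ->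
  (forall x : R, x \in `]0, 1[%R -> is_derive x 1 F (f x)) ->
  (forall x : R, x \in `]0, 1[%R -> `|F x| <= M) ->
  mu.-integrable `[0, 1] (EFin \o f).
Proof.
move=> mf f0 cf dF FM; move/measurable_EFinP: mf => mEf.
apply/integrableP; split; first exact: measurable_funTS.
under eq_integral do rewrite gee0_abs ?lee_fin//.
rewrite integral_itv_bndoo; last exact: measurable_funTS.
apply: (@le_lt_trans _ _ (M + M)%:E); last by rewrite ltry.
rewrite -bigcup_cut.
have /= cv := @ge0_nondecreasing_set_cvg_integral _ (measurableTypeR R) R _
  (EFin \o f) mu
  cut_nondecreasing (fun=> measurable_itv _) (fun=> measurable_funTS mEf)
  (fun i x _ => f0 x).
rewrite -(cvg_lim _ cv)//; apply: lime_le; first by apply/cvg_ex; eexists; exact: cv.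
apply: nearW => n; rewrite (cut_FTC n cf dF) lee_fin.
have := cut_end_gt0 n; have := cut_end_lt_half n.
move: (cut_end n : R) => a ? ?; rewrite (le_trans (ler_norm _))//.
by rewrite (le_trans (ler_normB _ _))// lerD// FM// in_itv/=; apply/andP; split; lra.
Qed.

(** Integrability makes the indefinite integral of f continuous at 0 and 1, so the truncated
    integrals converge to the full one; they also equal differences of F, which tend to 0. *)
Lemma integral_FTC_vanishing f F :
  mu.-integrable `[0, 1] (EFin \o f) ->
  {in `]0, 1[%R, continuous f} ->
  (forall x : R, x \in `]0, 1[%R -> is_derive x 1 F (f x)) ->
  F x @[x --> 0^'+] --> 0 -> F x @[x --> 1^'-] --> 0 ->
  \int[mu]_(x in `[0, 1]) f x = 0.
Proof.
move=> fi cf dF F0 F1.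
pose a n : R := cut_end n.
have a0 n : 0 < a n by exact: cut_end_gt0.
have a1 n : a n < 1 - a n by exact: cut_end_lt_half.
have cv0 : a @ \oo --> (0 : R).
  have := @cvg_harmonic R; rewrite -(cvg_shiftn 2).
  by under eq_fun do rewrite addn2.
have cva : a @ \oo --> 0^'+.
  by move=> P /cv0[N _ hN]; exists N => // n Nn; exact: hN Nn (a0 n).
have cvb : (1 - a n) @[n --> \oo] --> 1^'-.
  have cv1 : (1 - a n) @[n --> \oo] --> (1 : R).
    by rewrite -[X in _ --> X]subr0; apply: cvgB => //; exact: cvg_cst.
  by move=> P /cv1[N _ hN]; exists N => // n Nn; apply: (hN n Nn); rewrite gtrBl.
pose G x := \int[mu]_(t in `[0, x]) f t.
have GF n : G (1 - a n) - G (a n) = F (1 - a n) - F (a n).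
  have an := a0 n; have an1 := a1 n.
  have fi' : mu.-integrable `[0, 1 - a n] (EFin \o f).
    by apply: integrableS fi => //; apply: subset_itvl; rewrite bnd_simp; lra.
  rewrite /G Rintegral_itvB ?bnd_simp//; [|lra|lra].
  rewrite Rintegral_itv_obnd_cbnd; last first.
    by apply: integrableS fi => //; apply: subset_itv; rewrite bnd_simp; lra.
  by rewrite /Rintegral (cut_FTC n cf dF).
have G1 : G (1 - a n) - G (a n) @[n --> \oo] --> G 1 - 0.
  apply: cvgB; first exact: cvg_comp cvb (parameterized_integral_cvg_at_left ltr01 fi).
  exact: cvg_comp cv0 (parameterized_integral_cvg_left ltr01 fi).
have F01 : F (1 - a n) - F (a n) @[n --> \oo] --> 0 - (0 : R).
  by apply: cvgB; [exact: cvg_comp cvb F1|exact: cvg_comp cva F0].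
rewrite -[LHS]/(G 1) -[LHS]subr0 -[RHS]subr0.
move: G1; under eq_fun do rewrite GF.
by move=> G1; exact: cvg_unique G1 F01.
Qed.

End Truncation.

(** * Integrability of the beta weight and integration by parts *)

Section BetaIntegral.
Context {R : realType}.
Notation mu := (@lebesgue_measure R).

Definition beta_weight (y z t : R) : R := t `^ (y - 1) * (1 - t) `^ (z - 1).

Lemma beta_weight_ge0 y z t : 0 <= beta_weight y z t.
Proof. by rewrite mulr_ge0 ?powR_ge0. Qed.

Lemma measurable_onem_powR (a : R) :
  measurable_fun [set: R] (fun t : R => (1 - t) `^ a).
Proof. by apply: (measurableT_comp (measurable_powR a)); exact: measurable_funB. Qed.

Lemma measurable_beta_weight y z : measurable_fun [set: R] (beta_weight y z).
Proof.
by apply: measurable_funM; [exact: measurable_powR|exact: measurable_onem_powR].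
Qed.

Lemma is_derive_onem_powR (a x : R) : x < 1 ->
  is_derive x 1 (fun t : R => (1 - t) `^ a) (- (a * (1 - x) `^ (a - 1))).
Proof.
move=> x1; have x0 : 0 < 1 - x by rewrite subr_gt0.
have dg : is_derive x 1 (fun t : R => 1 - t) (-1).
  by apply: is_derive_eq; rewrite add0r mul1r.
have := @is_derive1_comp R (fun t => t `^ a) (fun t => 1 - t) x _ _
  (is_derive1_powR a x0) dg.
by rewrite mulrN1.
Qed.

(** Write the power as t^y / t, where t^y <= 1 and 1/t <= 2. *)
Lemma powR_sub1_le (t y : R) : 1 / 2 <= t -> t <= 1 -> 0 < y -> t `^ (y - 1) <= 2.
Proof.
move=> t2 t1 y0; have t0 : 0 < t by lra.
have -> : t `^ (y - 1) = t `^ y / t.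
  rewrite powRB ?powRr1 ?(ltW t0)//; apply/implyP => _; by rewrite gt_eqF.
rewrite ler_pdivrMr//.
rewrite (@le_trans _ _ 1)//; last lra.
by rewrite -(powRr0 t) ger_powR ?t0// ltW.
Qed.

(** One of t and 1 - t is at least 1/2, so its power is at most 2 and the product is at most twice
    the other power. The majorant has singularities at both ends, but an elementary primitive. *)
Lemma beta_weight_le y z t : 0 < y -> 0 < z -> t \in `[0, 1] ->
  beta_weight y z t <= 2 * (t `^ (y - 1) + (1 - t) `^ (z - 1)).
Proof.
move=> y0 z0; rewrite in_itv/= => /andP[t0 t1].
have [t2|t2] := leP t (1 / 2); rewrite /beta_weight.
  have := @powR_sub1_le (1 - t) z; have := powR_ge0 t (y - 1).
  have := powR_ge0 (1 - t) (z - 1).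
  move: (t `^ _) ((1 - t) `^ _) => a b b0 a0 /(_ _ _ z0) b2.
  have {}b2 : b <= 2 by apply: b2; lra.
  by nra.
have := @powR_sub1_le t y; have := powR_ge0 t (y - 1).
have := powR_ge0 (1 - t) (z - 1).
move: (t `^ _) ((1 - t) `^ _) => a b b0 a0 /(_ _ _ y0) b2.
have {}b2 : a <= 2 by apply: b2; lra.
by nra.
Qed.

Lemma continuous_powR (a x : R) : 0 < x -> {for x, continuous (fun t : R => t `^ a)}.
Proof.
move=> x0; apply: differentiable_continuous; apply/derivable1_diffP.
by have [] := is_derive1_powR a x0.
Qed.

Lemma continuous_onem_powR (a x : R) : x < 1 ->
  {for x, continuous (fun t : R => (1 - t) `^ a)}.
Proof.
move=> x1; apply: differentiable_continuous; apply/derivable1_diffP.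
by have [] := is_derive_onem_powR a x1.
Qed.

Lemma onem_at_left1 : 1 - x @[x --> (1 : R)^'-] --> (0 : R)^'+.
Proof.
move=> P [e /= e0 eP]; exists e => //= x /= xe x1.
by apply: eP; rewrite /= ?subr_gt0// sub0r normrN.
Qed.

Lemma integrable_beta_weight y z : 0 < y -> 0 < z ->
  mu.-integrable `[0, 1] (EFin \o beta_weight y z).
Proof.
move=> y0 z0.
pose g (t : R) : R := t `^ (y - 1) + (1 - t) `^ (z - 1).
(* A primitive of the majorant [g], bounded because y and z are positive. *)
pose G (t : R) : R := y^-1 * t `^ y - z^-1 * (1 - t) `^ z.
have gi : mu.-integrable `[0, 1] (EFin \o g).
  apply: (@ge0_integrable_FTC R g G (y^-1 + z^-1)).
  - by apply: measurable_funD; [exact: measurable_powR|exact: measurable_onem_powR].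
  - by move=> x; rewrite addr_ge0 ?powR_ge0.
  - move=> x; rewrite in_itv/= => /andP[x0 x1]; apply: cvgD; first exact: continuous_powR.
    exact: continuous_onem_powR.
  - move=> x; rewrite in_itv/= => /andP[x0 x1].
    have d1 := is_derive1_powR y x0; have d2 := is_derive_onem_powR z x1.
    have := is_deriveB (is_deriveZ y^-1 d1) (is_deriveZ z^-1 d2).
    rewrite scalerN opprK !scalerA !mulVf ?gt_eqF// !scale1r.
    exact.
  - move=> x; rewrite in_itv/= => /andP[x0 x1].
    rewrite (le_trans (ler_normB _ _))// !normrM !ger0_norm ?powR_ge0 ?invr_ge0
      ?(ltW y0) ?(ltW z0)//.
    have le1 (t a : R) : 0 < t -> t < 1 -> 0 < a -> t `^ a <= 1.
      by move=> t0 t1 a0; rewrite -(powRr0 t) ger_powR ?t0 ?ltW.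
    by rewrite lerD// ler_piMr ?invr_ge0 ?(ltW y0) ?(ltW z0)//; apply: le1 => //; lra.
have g2i : mu.-integrable `[0, 1] (fun x => 2%:E * (EFin \o g) x)%E.
  exact: integrableZl.
apply: le_integrable g2i => //.
  by apply: measurable_funTS; apply/measurable_EFinP; exact: measurable_beta_weight.
move=> t t01; rewrite /= lee_fin ger0_norm ?beta_weight_ge0//.
rewrite (le_trans _ (ler_norm _))//; exact: beta_weight_le.
Qed.

Lemma powR_mulXn (t y : R) (l : nat) : 0 <= t -> 0 < y ->
  t `^ (y - 1) * t ^+ l = t `^ (y + l%:R - 1).
Proof.
move=> t0 y0; case: l => [|l]; first by rewrite mulr1 addr0.
move: t0; rewrite le_eqVlt => /predU1P[<-|t0].
  (* At t = 0 both sides vanish: the exponent on the right is y + l > 0. *)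
  rewrite expr0n mulr0 powR0// gt_eqF// -natr1 addrA addrK.
  by rewrite ltr_wpDr.
rewrite -powR_mulrn ?ltW// -powRD 1?addrAC//.
by apply/implyP => _; rewrite gt_eqF.
Qed.

(** The difference of the two integrands is the derivative of t^y (1 - t)^z, which vanishes at both
    ends. *)
Lemma beta_FTC (y z : R) : 0 < y -> 0 < z -> y * beta y (z + 1) = z * beta (y + 1) z.
Proof.
move=> y0 z0.
have y10 : 0 < y + 1 by exact: addr_gt0.
have z10 : 0 < z + 1 by exact: addr_gt0.
pose f (t : R) := y * beta_weight y (z + 1) t - z * beta_weight (y + 1) z t.
pose F (t : R) := t `^ y * (1 - t) `^ z.
have i1 := integrable_beta_weight y0 z10.
have i2 := integrable_beta_weight y10 z0.
have fi : mu.-integrable `[0, 1] (EFin \o f).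
  rewrite (_ : EFin \o f = fun x => (y%:E * (beta_weight y (z + 1) x)%:E -
    z%:E * (beta_weight (y + 1) z x)%:E)%E)//.
  by apply: integrableB => //; exact: integrableZl.
have : \int[mu]_(t in `[0, 1]) f t = 0.
  apply: (@integral_FTC_vanishing _ f F) => //.
  - move=> x; rewrite in_itv/= => /andP[x0 x1]; rewrite /f /beta_weight.
    by apply: cvgB; (apply: cvgM; [exact: cvg_cst|]); apply: cvgM;
      by [exact: continuous_powR|exact: continuous_onem_powR].
  - move=> x; rewrite in_itv/= => /andP[x0 x1].
    have := is_deriveM (is_derive1_powR y x0) (is_derive_onem_powR z x1).
    rewrite /f /beta_weight !addrK.
    move=> H; apply: (is_derive_eq H); rewrite /GRing.scale/=; ring.
  - have := cvgM (powR_cvg0 y0) (cvg_at_right_filter (@continuous_onem_powR z 0 ltr01)).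
    by rewrite mul0r; apply.
  - have := cvgM (cvg_at_left_filter (@continuous_powR y 1 ltr01))
      (cvg_comp _ _ onem_at_left1 (powR_cvg0 z0)).
    by rewrite mulr0; apply.
rewrite /f (@RintegralB _ _ _ mu `[0, 1]%classic (fun t => y * beta_weight y (z + 1) t)
  (fun t => z * beta_weight (y + 1) z t)); [|exact: measurable_itv
  |exact: (integrableZl _ _ i1)|exact: (integrableZl _ _ i2)].
rewrite (@RintegralZl _ _ _ mu _ (beta_weight y (z + 1)))//.
rewrite (@RintegralZl _ _ _ mu _ (beta_weight (y + 1) z))//.
by move/eqP; rewrite subr_eq0 => /eqP.
Qed.

End BetaIntegral.

(** * Moments of the beta weight and positivity *)

Section BetaMoments.
Context {R : realType}.
Notation mu := (@lebesgue_measure R).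

Lemma integrable_RZl d (T : measurableType d) (m : {measure set T -> \bar R})
    (D : set T) (r : R) (f : T -> R) :
  measurable D -> m.-integrable D (EFin \o f) ->
  m.-integrable D (EFin \o fun x => r * f x).
Proof. by move=> mD; exact: integrableZl. Qed.

Lemma integrable_Rsum d (T : measurableType d) (m : {measure set T -> \bar R})
    (D : set T) (I : Type) (s : seq I) (f : I -> T -> R) :
  measurable D -> (forall i, m.-integrable D (EFin \o f i)) ->
  m.-integrable D (EFin \o fun x => \sum_(i <- s) f i x).
Proof.
move=> mD fi; rewrite (_ : _ \o _ = fun x => (\sum_(i <- s) (f i x)%:E)%E).
  by apply: integrable_sum => // i _; exact: fi.
by apply/funext => x /=; rewrite sumEFin.
Qed.

Lemma Rintegral_sum d (T : measurableType d) (m : {measure set T -> \bar R})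
    (D : set T) (I : Type) (s : seq I) (f : I -> T -> R) :
  measurable D -> (forall i, m.-integrable D (EFin \o f i)) ->
  \int[m]_(x in D) (\sum_(i <- s) f i x) = \sum_(i <- s) \int[m]_(x in D) f i x.
Proof.
move=> mD fi; elim: s => [|i s ih].
  rewrite big_nil (@eq_Rintegral _ _ _ _ _ (fun=> 0)); last by move=> x _; rewrite big_nil.
  by rewrite Rintegral_cst// mul0r.
rewrite big_cons -ih -RintegralD//; last exact: integrable_Rsum.
by apply: eq_Rintegral => x _; rewrite big_cons.
Qed.

Lemma beta_weight_shift (y z t : R) (l p : nat) : 0 < y -> 0 < z -> t \in `[0, 1] ->
  (1 - t) ^+ p * t ^+ l * beta_weight y z t = beta_weight (y + l%:R) (z + p%:R) t.
Proof.
rewrite in_itv/= => y0 z0 /andP[t0 t1]; rewrite /beta_weight -!powR_mulXn ?subr_ge0//.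
ring.
Qed.

Lemma addr_nat_gt0 (y : R) (l : nat) : 0 < y -> 0 < y + l%:R.
Proof. by move=> y0; rewrite ltr_wpDr. Qed.

(** Since t + (1 - t) = 1, B(y, z) = B(y, z + 1) + B(y + 1, z); with [beta_FTC] this is a linear
    system for the two summands. *)
Lemma betaS (y z : R) : 0 < y -> 0 < z ->
  (y + z) * beta (y + 1) z = y * beta y z /\ (y + z) * beta y (z + 1) = z * beta y z.
Proof.
move=> y0 z0; have H := beta_FTC y0 z0.
have i1 := integrable_beta_weight y0 (addr_nat_gt0 1 z0).
have i2 := integrable_beta_weight (addr_nat_gt0 1 y0) z0.
have : beta y z = beta y (z + 1) + beta (y + 1) z.
  rewrite /beta /incomplete_beta -RintegralD//; apply: eq_Rintegral => t t01.
  have := @beta_weight_shift y z t 1 0 y0 z0; have := @beta_weight_shift y z t 0 1 y0 z0.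
  rewrite inE/= in t01; move=> /(_ t01) + /(_ t01).
  rewrite !expr1 !expr0 !mulr1 !mul1r !addr0 /beta_weight => <- <-; ring.
move: H; move: (beta y z) (beta y (z + 1)) (beta (y + 1) z) => a b c H ->.
by split; [rewrite mulrDr H|rewrite mulrDr -H]; ring.
Qed.

(** The Pochhammer symbol, equal to Gamma(x + k) / Gamma(x) for x > 0; it expresses ratios of beta
    values without the Gamma function. *)
Definition rising (x : R) (k : nat) : R := \prod_(i < k) (x + i%:R).

Lemma rising0 x : rising x 0 = 1. Proof. exact: big_ord0. Qed.

Lemma risingS x k : rising x k.+1 = rising x k * (x + k%:R).
Proof. exact: big_ord_recr. Qed.

Lemma rising_gt0 x k : 0 < x -> 0 < rising x k.
Proof. by move=> x0; apply: prodr_gt0 => i _; exact: addr_nat_gt0. Qed.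

Lemma beta_shift (y z : R) (l p : nat) : 0 < y -> 0 < z ->
  rising (y + z) (l + p) * beta (y + l%:R) (z + p%:R) = rising y l * rising z p * beta y z.
Proof.
move=> y0 z0; elim: l => [|l ihl].
  rewrite add0n addr0 rising0 mul1r.
  elim: p => [|p ihp]; first by rewrite !rising0 addr0.
  have [_] := betaS y0 (addr_nat_gt0 p z0).
  rewrite !risingS -natr1 !addrA [in X in _ -> _ = X]mulrAC -ihp => H.
  by rewrite -mulrA H; ring.
have [+ _] := betaS (addr_nat_gt0 l y0) (addr_nat_gt0 p z0).
rewrite addSn !risingS -natr1 !addrA natrD [in X in _ -> X]addrA => H.
rewrite (_ : y + z + l%:R + p%:R = y + l%:R + z + p%:R); last ring.
rewrite -mulrA H [RHS](_ : _ = (rising y l * rising z p * beta y z) * (y + l%:R)); last ring.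
by rewrite -ihl; ring.
Qed.

(** On [1/4, 3/4] the weight is bounded below by a positive constant. *)
Lemma beta_gt0 (y z : R) : 0 < y -> 0 < z -> 0 < beta y z.
Proof.
move=> y0 z0.
have wi := integrable_beta_weight y0 z0.
(* Passing to the absolute value of the exponent treats both signs at once: t <= 1 gives t^a >=
   t^|a|. *)
have pl (t a : R) : 1 / 4 <= t <= 1 -> (1 / 4) `^ `|a| <= t `^ a.
  move=> /andP[t4 t1]; apply: (@le_trans _ _ (t `^ `|a|)).
    by rewrite ge0_ler_powR// nnegrE; lra.
  by rewrite ger_powR ?ler_norm//; apply/andP; split => //; lra.
pose c : R := (1 / 4) `^ `|y - 1| * (1 / 4) `^ `|z - 1|.
have c0 : 0 < c by rewrite mulr_gt0// powR_gt0; lra.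
have sub : `[(1 / 4 : R), 3 / 4] `<=` `[(0 : R), 1].
  by apply: subset_itv; rewrite bnd_simp; lra.
suff : ((c * (3 / 4 - 1 / 4))%:E <= (beta y z)%:E)%E.
  by rewrite lee_fin; apply: lt_le_trans; rewrite mulr_gt0//; lra.
have mw D : measurable_fun D (EFin \o beta_weight y z).
  by apply: measurable_funTS; apply/measurable_EFinP; exact: measurable_beta_weight.
rewrite [(beta y z)%:E]fineK; last exact: (integrable_fin_num _ wi).
have -> : ((c * (3 / 4 - 1 / 4))%:E = \int[mu]_(t in `[(1 / 4)%R, (3 / 4)%R]) (cst c%:E) t)%E.
  have lt43 : (1 / 4 : R) < 3 / 4 by lra.
  by rewrite integral_cst//= lebesgue_measure_itv/= lte_fin lt43.
apply: (@le_trans _ _ (\int[mu]_(t in `[(1 / 4)%R, (3 / 4)%R]) (EFin \o beta_weight y z) t)%E).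
  apply: ge0_le_integral => //.
  - by move=> t _; rewrite lee_fin ltW.
  - exact: mw.
  - move=> t /=; rewrite in_itv/= => /andP[t0 t1]; rewrite lee_fin.
    by rewrite ler_pM ?powR_ge0// pl//; apply/andP; split; lra.
apply: ge0_subset_integral => //; first exact: mw.
by move=> t _; rewrite lee_fin beta_weight_ge0.
Qed.

(** The ratio of rising factorials is B(y + l, z + p) / B(y, z), the mean of (1 - t)^p t^l under the
    normalised beta weight. The conclusion is thus the mean of the nonnegative polynomial at s = 1 -
    t. *)
Lemma beta_positivity (y z : R) (I : finType) (c : I -> R) (p l : I -> nat) :
  0 < y -> 0 < z ->
  (forall s, 0 <= s <= 1 -> 0 <= \sum_i c i * (s ^+ p i * (1 - s) ^+ l i)) ->
  0 <= \sum_i c i * (rising y (l i) * rising z (p i) / rising (y + z) (l i + p i)).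
Proof.
move=> y0 z0 H; have B0 := beta_gt0 y0 z0.
rewrite -(pmulr_lge0 _ B0) mulr_suml.
have -> : \sum_i
    c i * (rising y (l i) * rising z (p i) / rising (y + z) (l i + p i)) * beta y z
    = \int[mu]_(t in `[0, 1]) \sum_i c i * beta_weight (y + (l i)%:R) (z + (p i)%:R) t.
  rewrite Rintegral_sum//; last first.
    move=> i; apply: integrable_RZl => //.
    by apply: integrable_beta_weight; exact: addr_nat_gt0.
  apply: eq_bigr => i _; rewrite RintegralZl//; last first.
    by apply: integrable_beta_weight; exact: addr_nat_gt0.
  rewrite -[RHS]/(c i * beta _ _) -mulrA; congr (_ * _).
  have r0 : rising (y + z) (l i + p i) != 0 by rewrite gt_eqF// rising_gt0// addr_gt0.
  apply: (mulfI r0); rewrite beta_shift//.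
  by field.
apply: Rintegral_ge0 => t; rewrite [X in X -> _]/= => t01.
have H1 : 0 <= 1 - t <= 1 by move: t01; rewrite in_itv/= => /andP[? ?]; apply/andP; split; lra.
rewrite (eq_bigr (fun i => c i * ((1 - t) ^+ p i * (1 - (1 - t)) ^+ l i) * beta_weight y z t)).
  by rewrite -mulr_suml mulr_ge0 ?beta_weight_ge0// H.
by move=> i _; rewrite -beta_weight_shift// subKr mulrA.
Qed.
End BetaMoments.

(** * Polynomial approximation of a step function *)

Section StepApproximation.
Context {R : realType}.
Notation mu := (@lebesgue_measure R).

Lemma bernoulli_sub (v : R) k : 0 <= v <= 1 -> 1 - k%:R * v <= (1 - v) ^+ k.
Proof.
move=> /andP[v0 v1]; elim: k => [|k ih]; first by rewrite mul0r subr0 expr0.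
rewrite exprS (le_trans _ (ler_wpM2l _ ih))//; last by rewrite subr_ge0.
have : 0 <= k%:R * v * v by rewrite !mulr_ge0.
by rewrite -natr1; move: (k%:R) => K; nra.
Qed.

Lemma bernoulli_inv (v : R) k : 0 <= v <= 1 -> (1 - v) ^+ k * (k%:R * v) <= 1.
Proof.
move=> /andP[v0 v1]; have w0 : 0 <= 1 - v by rewrite subr_ge0.
(* The extra 1 makes the induction work: (1 - v)(1 + (k + 1)v) <= 1 + kv. *)
suff H : (1 - v) ^+ k * (1 + k%:R * v) <= 1.
  by apply: le_trans H; rewrite ler_wpM2l ?exprn_ge0// lerDr.
elim: k => [|k ih]; first by rewrite mul0r addr0 expr0 mulr1.
apply: le_trans ih; rewrite exprSr -mulrA ler_wpM2l ?exprn_ge0//.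
have : 0 <= k%:R * v * v by rewrite !mulr_ge0.
by rewrite -natr1; move: (k%:R) => K; nra.
Qed.

(* (1 - u^m)^(2^m) tends to 1 for 0 <= u < 1/2 and to 0 for 1/2 < u <= 1. *)
Definition step_approx (c : R) (m : nat) (t : R) : R :=
  (1 - (1 / 2 + (t - c) / 2) ^+ m) ^+ (2 ^ m).

Lemma step_approx_itv c m t : 0 <= c <= 1 -> 0 <= t <= 1 -> 0 <= step_approx c m t <= 1.
Proof.
move=> /andP[c0 c1] /andP[t0 t1]; rewrite /step_approx.
set u := 1 / 2 + _; have u0 : 0 <= u by rewrite /u; lra.
have u1 : u <= 1 by rewrite /u; lra.
have v0 : 0 <= u ^+ m by exact: exprn_ge0.
have v1 : u ^+ m <= 1 by exact: exprn_ile1.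
by rewrite exprn_ge0 ?subr_ge0//= exprn_ile1 ?subr_ge0// gerBl.
Qed.

(** Bernoulli's inequality with exponent 2^m, where 2^m u^m = (2u)^m and 2u = 1 - (c - t). *)
Lemma step_approx_ge c m t : 0 <= c <= 1 -> 0 <= t <= 1 ->
  1 - (1 - (c - t)) ^+ m <= step_approx c m t.
Proof.
move=> /andP[c0 c1] /andP[t0 t1]; rewrite /step_approx.
set u := 1 / 2 + _; have u0 : 0 <= u by rewrite /u; lra.
have u1 : u <= 1 by rewrite /u; lra.
have -> : 1 - (c - t) = 2 * u by rewrite /u; field.
rewrite exprMn -natrX bernoulli_sub//.
by rewrite exprn_ge0//= exprn_ile1.
Qed.

Lemma cvg_step_approx_lt c t : 0 <= c <= 1 -> 0 <= t -> t < c ->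
  step_approx c m t @[m --> \oo] --> (1 : R).
Proof.
move=> cI t0 tc; have tI : 0 <= t <= 1 by apply/andP; split => //; lra.
apply: (@squeeze_cvgr _ _ _ _ (fun m => 1 - (1 - (c - t)) ^+ m) (fun=> 1)).
- by apply: nearW => m; rewrite step_approx_ge//; case/andP: (step_approx_itv m cI tI).
- rewrite -[X in _ --> X]subr0; apply: cvgB; first exact: cvg_cst.
  by apply: cvg_expr; rewrite ger0_norm; lra.
- exact: cvg_cst.
Qed.

Lemma cvg_step_approx_gt c t : 0 <= c <= 1 -> t <= 1 -> c < t ->
  step_approx c m t @[m --> \oo] --> (0 : R).
Proof.
move=> cI t1 ct; have tI : 0 <= t <= 1 by apply/andP; split => //; lra.
have q1 : 1 < 1 + (t - c) by lra.
(* The upper bound is (2u)^(-m) with 2u = 1 + (t - c) > 1, by [bernoulli_inv]. *)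
apply: (@squeeze_cvgr _ _ _ _ (fun=> 0) (fun m => (1 + (t - c))^-1 ^+ m)).
- apply: nearW => m; have /andP[-> _] /= := step_approx_itv m cI tI.
  rewrite exprVn -[leRHS]mul1r ler_pdivlMr ?exprn_gt0//; last lra.
  have -> : 1 + (t - c) = 2 * (1 / 2 + (t - c) / 2) by field.
  rewrite exprMn -natrX bernoulli_inv//.
  by rewrite exprn_ge0 ?exprn_ile1//; lra.
- exact: cvg_cst.
- apply: cvg_expr; rewrite ger0_norm ?invr_ge0; last lra.
  by rewrite invf_lt1//; lra.
Qed.

Lemma measurable_step_approx c m : measurable_fun [set: R] (step_approx c m).
Proof.
apply: measurable_funX; apply: measurable_funB => //; apply: measurable_funX.
apply: measurable_funD => //; apply: measurable_funM => //; exact: measurable_funB.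
Qed.

Lemma integrable_step_approx (y z c : R) m : 0 < y -> 0 < z -> 0 <= c <= 1 ->
  mu.-integrable `[0, 1] (EFin \o fun t => step_approx c m t * beta_weight y z t).
Proof.
move=> y0 z0 cI; apply: le_integrable (integrable_beta_weight y0 z0) => //.
  apply: measurable_funTS; apply/measurable_EFinP; apply: measurable_funM.
    exact: measurable_step_approx.
  exact: measurable_beta_weight.
move=> t; rewrite [X in X -> _]/= in_itv/= => tI.
have /andP[s0 s1] := step_approx_itv m cI tI.
rewrite /= lee_fin normrM ler_piMl// ger0_norm//.
Qed.

(** Dominated convergence: the approximants lie between 0 and 1 and tend to the indicator of [0, c]
    except at t = c. *)
Lemma cvg_integral_step_approx (y z c : R) : 0 < y -> 0 < z -> 0 < c < 1 ->
  \int[mu]_(t in `[0, 1]) (step_approx c m t * beta_weight y z t) @[m --> \oo]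
    --> incomplete_beta c y z.
Proof.
move=> y0 z0 /andP[c0 c1]; have cI : 0 <= c <= 1 by rewrite !ltW.
pose f (m : nat) (t : R) := (step_approx c m t * beta_weight y z t)%:E.
pose g (t : R) : \bar R := ((EFin \o beta_weight y z) \_ `[0, c]) t.
have wi := integrable_beta_weight y0 z0.
have mw D : measurable_fun D (EFin \o beta_weight y z).
  by apply: measurable_funTS; apply/measurable_EFinP; exact: measurable_beta_weight.
have fi m : mu.-integrable `[0, 1] (f m) by exact: integrable_step_approx.
have sub : `[0, c]%classic `<=` (`[0, 1]%classic : set R).
  by apply: subset_itvl; rewrite bnd_simp ltW.
have gE : (\int[mu]_(t in `[0%R, 1%R]) g t = (incomplete_beta c y z)%:E)%E.
  rewrite /g -integral_mkcondr setIidr// /incomplete_beta fineK//.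
  by apply: integrable_fin_num => //; apply: integrableS wi.
have mg : @measurable_fun _ _ (measurableTypeR R) _ `[0, 1]%classic g.
  by apply/measurable_restrict => //; exact: mw.
have fg : {ae mu, forall t, `[0, 1]%classic t -> f ^~ t @ \oo --> g t}.
  exists [set c]; split => //; first exact: lebesgue_measure_set1.
  move=> t /=; apply: contra_notP => tc; rewrite in_itv/= => /andP[t0 t1].
  rewrite /f /g patchE; have [ct|ct|ct] := ltgtP c t; last by case: tc.
    rewrite memNset; last by rewrite /= in_itv/= t0 leNgt ct.
    apply: cvg_EFin; first exact: nearW.
    rewrite -[X in _ --> X](mul0r (beta_weight y z t)).
    by apply: cvgMr_tmp; exact: cvg_step_approx_gt.
  rewrite mem_set; last by rewrite /= in_itv/= t0 ltW.
  apply: cvg_EFin; first exact: nearW.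
  rewrite -[X in _ --> X](mul1r (beta_weight y z t)).
  by apply: cvgMr_tmp; exact: cvg_step_approx_lt.
have fw : {ae mu, forall t n, `[0, 1]%classic t ->
    (`|f n t| <= (EFin \o beta_weight y z) t)%E}.
  apply: aeW => t n; rewrite [X in X -> _]/= in_itv/= => tI.
  have /andP[s0 s1] := step_approx_itv n cI tI.
  rewrite /f /= lee_fin normrM !ger0_norm// ?beta_weight_ge0//.
  by rewrite ler_piMl// beta_weight_ge0.
have [_ _] := @dominated_convergence _ _ R mu `[0, 1]%classic
   (measurable_itv _) f g (EFin \o beta_weight y z)
   (fun m => measurable_int _ (fi m)) mg fg wi fw.
by rewrite gE => /fine_cvg.
Qed.

Lemma incomplete_beta_cvg (y z x : R) : 0 < y -> 0 < z -> 0 < x < 1 ->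
  incomplete_beta c y z @[c --> x^'+] --> incomplete_beta x y z.
Proof.
move=> y0 z0 xI; apply: cvg_at_right_filter.
have /(continuous_within_itvP _ ltr01)[+ _ _] :=
  parameterized_integral_continuous ler01 (integrable_beta_weight y0 z0).
by apply; rewrite in_itv.
Qed.

(** Two successive limits: for fixed c > x the error (1 - (c - x))^m dies out as m grows; then c
    decreases to x, using continuity of the incomplete beta function. *)
Lemma beta_cap_bound (y z x K : R) : 0 < y -> 0 < z -> 0 < x < 1 ->
  (forall c m, x < c < 1 -> (1 - (1 - (c - x)) ^+ m) * beta y z <=
    K * \int[mu]_(t in `[0, 1]) (step_approx c m t * beta_weight y z t)) ->
  beta y z <= K * incomplete_beta x y z.
Proof.
move=> y0 z0 /andP[x0 x1] H.
have step c : x < c < 1 -> beta y z <= K * incomplete_beta c y z.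
  move=> /[dup] xcI /andP[xc c1].
  have c01 : 0 < c < 1 by rewrite c1 (lt_trans x0).
  have l1 : (1 - (1 - (c - x)) ^+ m) * beta y z @[m --> \oo] --> (1 - 0) * beta y z.
    apply: cvgMr_tmp; apply: cvgB; first exact: cvg_cst.
    by apply: cvg_expr; rewrite ger0_norm; lra.
  have l2 := cvgMl_tmp (a := K) (cvg_integral_step_approx y0 z0 c01).
  have := ler_cvg_to l1 (l2 _); rewrite subr0 mul1r; apply.
  by apply: nearW => m; exact: H.
have xI : 0 < x < 1 by rewrite x0.
apply: (@cvgr_to_ge _ _ _ _ _ _ _ (cvgMl_tmp (a := K) (incomplete_beta_cvg y0 z0 xI))).
near=> c; apply: step; apply/andP; split; near: c.
  exact: nbhs_right_gt.
exact: nbhs_right_lt.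
Unshelve. all: by end_near.
Qed.

End StepApproximation.

(** * Means of even functions over the unit sphere *)

Section SphereMean.
Context {R : realType}.

Definition dot n (x y : 'I_n -> R) : R := \sum_i x i * y i.

Lemma dotC n (x y : 'I_n -> R) : dot x y = dot y x.
Proof. by apply: eq_bigr => i _; rewrite mulrC. Qed.

Lemma dot_ge0 n (x : 'I_n -> R) : 0 <= dot x x.
Proof. by apply: sumr_ge0 => i _; rewrite -expr2 sqr_ge0. Qed.

Definition cons_fun n (t : R) (x : 'I_n -> R) : 'I_n.+1 -> R :=
  fun i => if unlift ord0 i is Some j then x j else t.

Lemma dot_cons n (t : R) (x : 'I_n -> R) u :
  dot (cons_fun t x) u = t * u ord0 + dot x (u \o lift ord0).
Proof.
rewrite /dot big_ord_recl /cons_fun unlift_none; congr (_ + _).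
by apply: eq_bigr => i _; rewrite liftK.
Qed.

Lemma dotS n (u v : 'I_n.+1 -> R) :
  dot u v = u ord0 * v ord0 + dot (u \o lift ord0) (v \o lift ord0).
Proof. by rewrite /dot big_ord_recl. Qed.

Lemma dotZl n (a : R) (x y : 'I_n -> R) : dot (fun i => a * x i) y = a * dot x y.
Proof. by rewrite /dot mulr_sumr; apply: eq_bigr => i _; rewrite mulrA. Qed.

Lemma sum_even_ord (F : nat -> R) k : (forall j, F (2 * j).+1 = 0) ->
  \sum_(i < (2 * k).+1) F i = \sum_(j < k.+1) F (2 * j)%N.
Proof.
move=> F0; elim: k => [|k ih]; first by rewrite !big_ord_recr !big_ord0.
rewrite mulnS !add2n 2!big_ord_recr/= ih F0 addr0 [RHS]big_ord_recr/=.
by rewrite mulnS add2n.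
Qed.

(** Odd powers of a cancel between the two expansions; as the total degree is even, only even powers
    of b remain too. *)
Lemma exprD_even (a b : R) k :
  (a + b) ^+ (2 * k) + (- a + b) ^+ (2 * k) =
  2 * \sum_(j < k.+1) 'C(2 * k, 2 * j)%:R * ((a ^+ 2) ^+ (k - j) * (b ^+ 2) ^+ j).
Proof.
rewrite (addrC a) (addrC (- a)) !exprDn -big_split/= mulr_sumr.
pose F i := (b ^+ (2 * k - i) * a ^+ i + b ^+ (2 * k - i) * (- a) ^+ i) *+ 'C(2 * k, i).
transitivity (\sum_(i < (2 * k).+1) F i).
  by apply: eq_bigr => i _; rewrite /F mulrnDl.
rewrite sum_even_ord => [|j]; last first.
  by rewrite /F exprNn -signr_odd/= oddM/= expr1 mulN1r mulrN subrr mul0rn.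
rewrite (reindex_inj rev_ord_inj)/=; apply: eq_bigr => j _.
have jk : (j <= k)%N by rewrite -ltnS.
rewrite subSS /F [(- a) ^+ _]exprM sqrrN -exprM -mulnBr subKn//.
have -> : 'C(2 * k, 2 * (k - j)) = 'C(2 * k, 2 * j) by rewrite mulnBr bin_sub // leq_mul2l.
by rewrite -!exprM -mulr_natl; ring.
Qed.

Lemma rising_half k : rising (1 / 2 : R) k * (4 ^+ k * k`!%:R) = (2 * k)`!%:R.
Proof.
elim: k => [|k ih]; first by rewrite rising0 muln0 fact0 !mulr1.
rewrite risingS mulnS add2n !factS !natrM -ih exprS -!natr1 natrM; by field.
Qed.

(** By [rising_half] both sides equal (2k)! / (4^k j! (k - j)!). This turns the coefficients
    produced by slicing into the plain binomials needed to resum. *)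
Lemma rising_half_bin k j : (j <= k)%N ->
  'C(2 * k, 2 * j)%:R * (rising (1 / 2) (k - j) * rising (1 / 2) j) =
  'C(k, j)%:R * rising (1 / 2 : R) k.
Proof.
move=> jk.
have f0 m : m`!%:R != 0 :> R by rewrite pnatr_eq0 -lt0n fact_gt0.
have e0 m : 4 ^+ m != 0 :> R by rewrite expf_neq0// pnatr_eq0.
have H1 : 'C(2 * k, 2 * j)%:R * ((2 * j)`!%:R * (2 * (k - j))`!%:R) = (2 * k)`!%:R :> R.
  by rewrite -!natrM mulnBr bin_fact// leq_mul2l.
have H2 : 'C(k, j)%:R * (j`!%:R * (k - j)`!%:R) = k`!%:R :> R.
  by rewrite -!natrM bin_fact.
apply: (mulIf (f0 j)); apply: (mulIf (f0 (k - j)%N)); apply: (mulIf (e0 k)).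
move: H1; rewrite -!rising_half -H2 -[in 4 ^+ k](subnKC jk) exprD => H1.
transitivity ('C(2 * k, 2 * j)%:R * (rising (1 / 2) j * (4 ^+ j * j`!%:R) *
  (rising (1 / 2) (k - j) * (4 ^+ (k - j) * (k - j)`!%:R))) : R); first by ring.
by rewrite H1; ring.
Qed.

(** The added terms have j > k and a zero binomial. This allows one index range for sums of
    different degrees. *)
Lemma sum_bin_widen (F : nat -> R) k K : (k < K)%N ->
  \sum_(j < k.+1) 'C(2 * k, 2 * j)%:R * F j = \sum_(j < K) 'C(2 * k, 2 * j)%:R * F j.
Proof.
move=> kK; rewrite (big_ord_widen _ (fun j => 'C(2 * k, 2 * j)%:R * F j) kK).
rewrite big_mkcond; apply: eq_bigr => j _; case: ifPn => //.
by rewrite -leqNgt => kj; rewrite bin_small ?mul0r// ltn_pmul2l.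
Qed.

(* The even moments of the uniform probability measure on the unit sphere of R^n *)
Definition sphere_moment (n k : nat) : R := rising (1 / 2) k / rising (n%:R / 2) k.

(** The mean of <x, u>^(2k) over the sphere is the moment times |u|^(2k), so this is positivity of
    the mean. In the induction step the slice over first coordinate t = +-sqrt s is a sphere of
    radius sqrt (1 - s), to which the induction hypothesis applies, and s is then integrated against
    its beta distribution. *)
Theorem sphere_mean_ge0 n (I : finType) (a : I -> R) (u : I -> 'I_n.+1 -> R) (k : I -> nat) :
  (forall x, dot x x = 1 -> 0 <= \sum_i a i * dot x (u i) ^+ (2 * k i)) ->
  0 <= \sum_i a i * (sphere_moment n.+1 (k i) * dot (u i) (u i) ^+ k i).
Proof.
elim: n I a u k => [|n ih] I a u k H.
  (* The sphere is {1, -1} and the functions are even, so the value at 1 is the mean. *)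
  have := H (fun=> 1); rewrite /dot big_ord_recl big_ord0 mul1r addr0 => /(_ erefl).
  rewrite (eq_bigr (fun i => a i * (sphere_moment 1 (k i) * (\sum_j u i j * u i j) ^+ k i)))//.
  move=> i _; rewrite !big_ord_recl !big_ord0 mul1r !addr0 -expr2 exprM.
  by rewrite /sphere_moment divff ?mul1r// gt_eqF// rising_gt0.
(* A common bound on the degrees, so that the pairs (i, j) form a finite type. *)
pose K := (\max_i k i).+1.
have kK i : (k i < K)%N by rewrite ltnS leq_bigmax.
pose c (ij : I * 'I_K) : R := a ij.1 * 'C(2 * k ij.1, 2 * ij.2)%:R *
  (u ij.1 ord0 ^+ 2) ^+ (k ij.1 - ij.2).
pose v i := u i \o lift ord0.
(* For fixed s this is the mean over the two slices at height +-sqrt s, a polynomial in s. *)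
have key s : 0 <= s <= 1 -> 0 <= \sum_ij
   c ij * (sphere_moment n.+1 ij.2 * dot (v ij.1) (v ij.1) ^+ ij.2) *
     (s ^+ (k ij.1 - ij.2) * (1 - s) ^+ ij.2).
  move=> /andP[s0 s1].
  rewrite (eq_bigr (fun ij : I * 'I_K =>
    c ij * (s ^+ (k ij.1 - ij.2) * (1 - s) ^+ ij.2) *
      (sphere_moment n.+1 ij.2 * dot (v ij.1) (v ij.1) ^+ ij.2))); last by move=> ij _; ring.
  apply: (ih _ (fun ij => c ij * (s ^+ (k ij.1 - ij.2) * (1 - s) ^+ ij.2)) (v \o fst)
    (fun ij => ij.2 : nat)) => x x1.
  have s1' : 0 <= 1 - s by rewrite subr_ge0.
  pose y t := cons_fun t (fun i => Num.sqrt (1 - s) * x i).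
  have y1 t : t ^+ 2 = s -> dot (y t) (y t) = 1.
    move=> ts; rewrite dotS /y /= /cons_fun unlift_none -expr2 ts.
    rewrite (_ : _ \o _ = fun i => Num.sqrt (1 - s) * x i); last first.
      by apply/funext => i; rewrite /= liftK.
    by rewrite dotZl dotC dotZl x1 mulr1 -expr2 sqr_sqrtr// addrC subrK.
  have Hy t : t ^+ 2 = s ->
      0 <= \sum_i a i * (t * u i ord0 + Num.sqrt (1 - s) * dot x (v i)) ^+ (2 * k i).
    move=> ts; have := H _ (y1 _ ts).
    by under eq_bigr do rewrite dot_cons dotZl.
  (* Adding the values at both signs leaves only even powers of <x, v i>, as the induction
     hypothesis requires. *)
  have := addr_ge0 (Hy (Num.sqrt s) (sqr_sqrtr s0)) (Hy (- Num.sqrt s) _).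
  rewrite sqrrN => /(_ (sqr_sqrtr s0)).
  rewrite -big_split/=.
  under eq_bigr => i _.
    rewrite -mulrDr mulNr exprD_even.
    rewrite (@sum_bin_widen (fun j => _ ^+ (k i - j) * _ ^+ j) _ _ (kK i)).
    rewrite !exprMn !sqr_sqrtr// mulrCA mulr_sumr. over.
  rewrite -mulr_sumr pmulr_rge0// pair_bigA/=.
  rewrite [X in 0 <= X -> _](eq_bigr (fun ij : I * 'I_K => c ij *
    (s ^+ (k ij.1 - ij.2) * (1 - s) ^+ ij.2) * dot x (v ij.1) ^+ (2 * ij.2)))//.
  by move=> [i j] _ /=; rewrite /c /= (exprM _ 2 j) !exprMn; ring.
(* On the sphere of R^(n+2), s = x_0^2 has density proportional to s^(1/2 - 1) (1 - s)^((n+1)/2 -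
   1). *)
have := @beta_positivity R (n.+1%:R / 2) (1 / 2) _ _ _ _ _ _ key.
rewrite ?divr_gt0// => /(_ isT isT).
pose G i (j : nat) := (u i ord0 ^+ 2) ^+ (k i - j) * dot (v i) (v i) ^+ j.
rewrite (eq_bigr (fun ij : I * 'I_K => a ij.1 * (sphere_moment n.+2 (k ij.1) *
  ('C(k ij.1, ij.2)%:R * G ij.1 ij.2)))).
  rewrite -(pair_bigA _ (fun i (j : 'I_K) => a i * (sphere_moment n.+2 (k i) *
    ('C(k i, j)%:R * G i j))))/=.
  rewrite [X in 0 <= X -> _](eq_bigr (fun i =>
    a i * (sphere_moment n.+2 (k i) * dot (u i) (u i) ^+ k i)))//.
  move=> i _; rewrite -!mulr_sumr; congr (_ * (_ * _)).
  (* The sum over j is the binomial expansion of (u_0^2 + |v|^2)^k = |u|^(2k). *)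
  rewrite (dotS (u i)) -expr2 exprDn.
  rewrite (big_ord_widen _ (fun j => G i j *+ 'C(k i, j)) (kK i)).
  rewrite [RHS]big_mkcond; apply: eq_bigr => j _; rewrite mulr_natl; case: ifPn => //.
  by rewrite -leqNgt => kj; rewrite bin_small.
move=> [i j] _ /=.
rewrite /c /sphere_moment /= -!mulrA; congr (_ * _).
(* For j > k the subtraction k - j is truncated, but both binomials are 0. *)
have [jk|kj] := leqP j (k i); last first.
  by rewrite !bin_small ?ltn_pmul2l// !mul0r !mulr0.
have -> : n.+2%:R / 2 = n.+1%:R / 2 + 1 / 2 :> R by rewrite -[in LHS]natr1; field.
rewrite subnKC//.
have r0 m : rising (n.+1%:R / 2 : R) m != 0 by rewrite gt_eqF// rising_gt0// divr_gt0.
have r1 m : rising (n.+1%:R / 2 + 1 / 2 : R) m != 0.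
  by rewrite gt_eqF// rising_gt0// addr_gt0// divr_gt0.
have HB := rising_half_bin jk.
transitivity ('C(2 * k i, 2 * j)%:R * (rising (1 / 2) (k i - j) * rising (1 / 2) j) *
  G i j / rising (n.+1%:R / 2 + 1 / 2) (k i)).
  by rewrite /G; field; rewrite ?r0 ?r1.
by rewrite HB; ring.
Qed.

End SphereMean.

(** * The covering bound *)

Section Covering.
Context {R : realType}.
Notation mu := (@lebesgue_measure R).

Lemma dotDl n (x y z : 'I_n -> R) : dot (fun i => x i + y i) z = dot x z + dot y z.
Proof. by rewrite /dot -big_split; apply: eq_bigr => i _; rewrite mulrDl. Qed.

Lemma dot_lin n (x y : 'I_n -> R) (a b : R) :
  0 <= a ^+ 2 * dot x x + 2 * (a * b * dot x y) + b ^+ 2 * dot y y.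
Proof.
have := dot_ge0 (fun i => a * x i + b * y i).
rewrite dotDl !dotZl !(dotC _ (fun i => _ + _)) !dotDl !dotZl (dotC y x).
by congr (0 <= _); ring.
Qed.

Lemma dot_CauchySchwarz n (x y : 'I_n -> R) : dot x y ^+ 2 <= dot x x * dot y y.
Proof.
have := dot_ge0 y; rewrite le_eqVlt => /predU1P[y0|y0]; last first.
  have := dot_lin x y (dot y y) (- dot x y).
  rewrite (_ : _ + _ = dot y y * (dot x x * dot y y - dot x y ^+ 2)); last ring.
  by rewrite pmulr_rge0// subr_ge0.
rewrite -y0 mulr0; have [->|xy0] := eqVneq (dot x y) 0; first by rewrite expr0n.
(* If <y, y> = 0 and <x, y> is nonzero, this coefficient would give the square norm the value -1. *)
have := dot_lin x y 1 (- (dot x x + 1) / (2 * dot x y)).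
rewrite -y0 (_ : _ + _ = -1); last by field.
by rewrite lerNr oppr0 ler10.
Qed.

Lemma dot_unit_sqr n (x y : 'I_n -> R) : dot x x = 1 -> dot y y = 1 ->
  0 <= dot x y ^+ 2 <= 1.
Proof.
by move=> x1 y1; rewrite sqr_ge0 (le_trans (dot_CauchySchwarz _ _))// x1 y1 mulr1.
Qed.

(** Each 1 - <x, v_i>^2 is beta distributed with parameters (n + 1)/2 and 1/2, so the mean of the
    sum is N times a single beta integral, up to a positive factor. The identity is checked on each
    monomial of q. *)
Lemma sphere_mean_poly_ge0 n (N : nat) (v : 'I_N -> 'I_n.+2 -> R) (q : {poly R}) :
  (forall i, dot (v i) (v i) = 1) ->
  (forall x, dot x x = 1 -> 0 <= \sum_i q.[dot x (v i) ^+ 2]) ->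
  0 <= N%:R * \int[mu]_(t in `[0, 1]) (q.[1 - t] * beta_weight (n.+1%:R / 2) (1 / 2) t).
Proof.
move=> v1 H.
have y0 : 0 < n.+1%:R / 2 :> R by rewrite divr_gt0.
have z0 : 0 < 1 / 2 :> R by rewrite divr_gt0.
have B0 := beta_gt0 y0 z0.
have -> : \int[mu]_(t in `[0, 1]) (q.[1 - t] * beta_weight (n.+1%:R / 2) (1 / 2) t) =
    (\sum_(j < size q) q`_j * sphere_moment n.+2 j) * beta (n.+1%:R / 2) (1 / 2).
  transitivity (\int[mu]_(t in `[0, 1])
    \sum_(j < size q) q`_j * beta_weight (n.+1%:R / 2) (1 / 2 + j%:R) t).
    apply: eq_Rintegral => t; rewrite inE/= => t01.
    rewrite horner_coef mulr_suml; apply: eq_bigr => j _.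
    rewrite -[n.+1%:R / 2 in RHS]addr0 -(beta_weight_shift 0 j y0 z0 t01).
    by rewrite expr0 mulr1 -mulrA.
  have bi (j : nat) := integrable_beta_weight y0 (addr_nat_gt0 j z0).
  rewrite Rintegral_sum//; last by move=> j; exact: integrable_RZl.
  rewrite mulr_suml; apply: eq_bigr => j _; rewrite RintegralZl// -mulrA; congr (_ * _).
  rewrite -[LHS]/(beta _ _).
  have := beta_shift 0 j y0 z0; rewrite add0n rising0 addr0.
  have -> : n.+1%:R / 2 + 1 / 2 = n.+2%:R / 2 :> R by rewrite -[in RHS]natr1; field.
  have r0 : rising (n.+2%:R / 2 : R) j != 0 by rewrite gt_eqF// rising_gt0// divr_gt0.
  move=> E; apply: (mulfI r0); rewrite E /sphere_moment.
  by field.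
rewrite mulrA pmulr_lge0//.
have := @sphere_mean_ge0 R n.+1 _ (fun ij : 'I_N * 'I_(size q) => q`_ij.2) (v \o fst)
  (fun ij => ij.2 : nat).
rewrite -(pair_bigA _ (fun (i : 'I_N) (j : 'I_(size q)) =>
  q`_j * (sphere_moment n.+2 j * dot (v i) (v i) ^+ j)))/=.
under eq_bigr do under eq_bigr do rewrite v1 expr1n mulr1.
rewrite sumr_const card_ord -[(\sum_(_ < _) _) *+ _]mulr_natl; apply => x x1.
rewrite -(pair_bigA _ (fun (i : 'I_N) (j : 'I_(size q)) =>
  q`_j * dot x (v i) ^+ (2 * j)))/=.
rewrite (eq_bigr (fun i => q.[dot x (v i) ^+ 2])); first exact: H.
by move=> i _; rewrite horner_coef; apply: eq_bigr => j _; rewrite exprM.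
Qed.

(** The step approximation as a polynomial in s = <x, v>^2 = 1 - t, so that a step down in t becomes
    the indicator of a double cap. *)
Definition step_poly (c : R) (m : nat) : {poly R} :=
  (1 - (((2 - c) / 2)%:P - (1 / 2) *: 'X) ^+ m) ^+ (2 ^ m).

Lemma horner_step_poly c m s : (step_poly c m).[s] = step_approx c m (1 - s).
Proof.
rewrite /step_poly /step_approx !hornerE; congr ((1 - _ ^+ m) ^+ _); by field.
Qed.

(** The double cap |<x, v>| >= k is 1 - <x, v>^2 <= 1 - k^2, of normalised measure B(1 - k^2; ...) /
    B. Every point lies in at least two of the N double caps. *)
Theorem sphere_covering_bound n (N : nat) (v : 'I_N -> 'I_n.+2 -> R) (k : R) :
  0 < k < 1 -> (forall i, dot (v i) (v i) = 1) ->
  (forall x, dot x x = 1 -> exists i, k < dot x (v i)) ->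
  2 * beta (n.+1%:R / 2) (1 / 2) <=
    N%:R * incomplete_beta (1 - k ^+ 2) (n.+1%:R / 2) (1 / 2).
Proof.
move=> /andP[k0 k1] v1 cov.
have y0 : 0 < n.+1%:R / 2 :> R by rewrite divr_gt0.
have z0 : 0 < 1 / 2 :> R by rewrite divr_gt0.
have kk : 0 < k ^+ 2 < 1 by rewrite exprn_gt0//= exprn_ilt1// ltW.
have xI : 0 < 1 - k ^+ 2 < 1 by case/andP: kk => ? ?; apply/andP; split; lra.
(* The first basis vector has to be covered, so the family is nonempty and division by N is
   legitimate. *)
have N0 : N%:R != 0 :> R.
  have [|i _] := cov (fun i => (i == ord0)%:R).
    rewrite /dot (bigD1 ord0)//= big1 ?mulr1 ?addr0// => i /negbTE ->.
    by rewrite mulr0.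
  by rewrite pnatr_eq0 -lt0n (leq_ltn_trans _ (ltn_ord i)).
suff : beta (n.+1%:R / 2) (1 / 2) <=
    N%:R / 2 * incomplete_beta (1 - k ^+ 2) (n.+1%:R / 2) (1 / 2).
  by rewrite mulrAC ler_pdivlMr// mulrC.
apply: beta_cap_bound => // c m xc.
have cI : 0 <= c <= 1 by case/andP: xI xc => ? ? /andP[? ?]; apply/andP; split; lra.
set d := 1 - _.
(* On each double cap the step polynomial is at least [d]; the constant sums to 2d over the N caps,
   matching the double covering. *)
pose q := step_poly c m - (2 * d / N%:R)%:P.
have hs (x y : 'I_n.+2 -> R) : dot x x = 1 -> dot y y = 1 ->
    0 <= step_approx c m (1 - dot x y ^+ 2).
  move=> x1 y1; have /andP[? ?] := dot_unit_sqr x1 y1.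
  have tI : 0 <= 1 - dot x y ^+ 2 <= 1 by apply/andP; split; lra.
  by have /andP[] := step_approx_itv m cI tI.
have hd (x y : 'I_n.+2 -> R) : dot x x = 1 -> dot y y = 1 -> k ^+ 2 <= dot x y ^+ 2 ->
    d <= step_approx c m (1 - dot x y ^+ 2).
  move=> x1 y1 kxy; have /andP[? ?] := dot_unit_sqr x1 y1.
  have tI : 0 <= 1 - dot x y ^+ 2 <= 1 by apply/andP; split; lra.
  apply: le_trans (step_approx_ge m cI tI).
  rewrite lerD2l lerN2; case/andP: xI xc => ? ? /andP[? ?].
  by rewrite lerXn2r ?nnegrE//; lra.
have : forall x, dot x x = 1 -> 0 <= \sum_i q.[dot x (v i) ^+ 2].
  move=> x x1; have [i ki] := cov x x1.
  (* -x is covered too, by a different cap because k > 0. *)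
  have xN1 : dot (fun i => -1 * x i) (fun i => -1 * x i) = 1.
    by rewrite dotZl dotC dotZl x1; ring.
  have [j] := cov _ xN1; rewrite dotZl mulN1r ltrNr => kj.
  have ij : j != i by apply/eqP => ij; move: ki kj; rewrite ij; lra.
  under eq_bigr do rewrite hornerD hornerN hornerC horner_step_poly.
  rewrite sumrB sumr_const card_ord -[(_ / _) *+ _]mulr_natr divfK// subr_ge0.
  (* The caps i and j contribute at least [d] each; all other terms are nonnegative. *)
  rewrite (bigD1 i)//= (bigD1 j)//= addrA -[leLHS]addr0 lerD//; last first.
    by apply: sumr_ge0 => l _; exact: hs.
  rewrite mulr2n mulrDl !mul1r lerD// hd//.
    by rewrite lerXn2r ?nnegrE; lra.
  by rewrite -[leRHS]sqrrN lerXn2r ?nnegrE; lra.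
move=> /(sphere_mean_poly_ge0 v1).
have si := integrable_step_approx m y0 z0 cI.
have wi := integrable_beta_weight y0 z0.
rewrite (_ : \int[mu]_(t in `[0, 1]) _ =
  \int[mu]_(t in `[0, 1]) (step_approx c m t * beta_weight (n.+1%:R / 2) (1 / 2) t -
     (2 * d / N%:R) * beta_weight (n.+1%:R / 2) (1 / 2) t)); last first.
  apply: eq_Rintegral => t _.
  by rewrite /q hornerD hornerN hornerC horner_step_poly subKr mulrBl.
rewrite RintegralB//; last exact: integrable_RZl.
rewrite RintegralZl// -[\int[mu]_(t in _) beta_weight _ _ t]/(beta _ _).
rewrite mulrBr subr_ge0 => H.
rewrite mulrAC ler_pdivlMr// mulrC; apply: le_trans H.
by rewrite le_eqVlt; apply/orP; left; apply/eqP; field.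
Qed.
End Covering.

(** * Kissing configurations in hyperbolic space *)

Section Hyperbolic.
Context {R : realType}.

Definition space_part n (x : 'rV[R]_n.+1) : 'I_n -> R := fun i => x 0 (lift ord0 i).

Lemma lorentzE n (x y : 'rV[R]_n.+1) :
  lorentz x y = dot (space_part x) (space_part y) - x 0 ord0 * y 0 ord0.
Proof. by []. Qed.

Lemma lorentzDl n (x y z : 'rV[R]_n.+1) : lorentz (x + y) z = lorentz x z + lorentz y z.
Proof.
rewrite /lorentz !mxE mulrDl opprD [RHS]addrACA -big_split; congr (_ + _).
by apply: eq_bigr => i _; rewrite !mxE mulrDl.
Qed.

Lemma lorentzC n (x y : 'rV[R]_n.+1) : lorentz x y = lorentz y x.
Proof. by rewrite !lorentzE dotC mulrC. Qed.

(** The reverse Cauchy-Schwarz inequality for future timelike vectors. With spatial parts x', p',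
    Euclidean Cauchy-Schwarz for (c, x') and (1, p') gives (c + <x', p'>)^2 <= (c^2 + |x'|^2)(1 +
    |p'|^2) <= x_0^2 p_0^2. *)
Lemma lorentz_reverse_CS n (x : 'rV[R]_n.+1) (p : hyperbolic_space R n) (c : R) :
  0 <= c -> 0 < x 0 ord0 -> lorentz x x <= - c ^+ 2 -> c <= - lorentz x (val p).
Proof.
move=> c0 x0; have /andP[/eqP] := valP p; rewrite !lorentzE.
have := dot_CauchySchwarz (space_part x) (space_part (val p)).
have := dot_lin (space_part x) (space_part (val p)) 1 (- c).
move: (dot _ _) (dot _ _) (dot _ _) (x 0 _) (val p 0 _) x0 => P d M a b a0 H1 H2 H3 b0 H4.
suff : c + d <= a * b by lra.
apply: le_trans (ler_norm _) _; rewrite -ler_sqr ?nnegrE ?mulr_ge0 ?(ltW a0) ?(ltW b0)//.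
rewrite real_normK ?num_real// exprMn.
have -> : b ^+ 2 = P + 1 by rewrite expr2; lra.
have P0 : 0 <= P + 1 by rewrite -(_ : b * b = P + 1) ?mulr_ge0 ?ltW//; lra.
have : (c ^+ 2 + M) * (P + 1) <= a ^+ 2 * (P + 1).
  by rewrite ler_wpM2r// expr2; lra.
by move=> H; apply: (le_trans _ H); lra.
Qed.

Lemma cosh_ge1 (r : R) : 1 <= cosh r.
Proof.
have := expR_gt0 r; rewrite /cosh expRN; move: (expR r) => e e0.
rewrite ler_pdivlMr// mul1r -subr_ge0.
rewrite (_ : _ - _ = (e - 1) ^+ 2 / e); last by field; rewrite gt_eqF.
by rewrite divr_ge0 ?sqr_ge0 ?ltW.
Qed.

Definition sinh (r : R) : R := (expR r - expR (- r)) / 2.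

Lemma cosh2_sinh2 (r : R) : cosh r ^+ 2 - sinh r ^+ 2 = 1.
Proof.
have := expR_gt0 r; rewrite /cosh /sinh expRN; move: (expR r) => e e0.
by field; rewrite gt_eqF.
Qed.

Lemma cosh_double (r : R) : cosh (2 * r) = 2 * cosh r ^+ 2 - 1.
Proof.
have -> : 2 * r = r + r by ring.
have := expR_gt0 r; rewrite /cosh opprD !expRD expRN; move: (expR r) => e e0.
by field; rewrite gt_eqF.
Qed.

Lemma sinh_double (r : R) : sinh (2 * r) = 2 * (sinh r * cosh r).
Proof.
have -> : 2 * r = r + r by ring.
have := expR_gt0 r; rewrite /cosh /sinh opprD !expRD expRN.
by move: (expR r) => e e0; field; rewrite gt_eqF.
Qed.

Lemma arcosh_cosh (r : R) : 0 <= r -> arcosh (cosh r) = r.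
Proof.
move=> r0; have s0 : 0 <= sinh r.
  by rewrite divr_ge0// subr_ge0 ler_expR; lra.
rewrite /arcosh (_ : _ - 1 = sinh r ^+ 2); last by have := cosh2_sinh2 r; lra.
rewrite sqrtr_sqr ger0_norm// (_ : _ + _ = expR r) ?expRK//.
by rewrite /cosh /sinh; field.
Qed.

Lemma ler_arcosh (u w : R) : 1 <= u -> u <= w -> arcosh u <= arcosh w.
Proof.
move=> u1 uw; have s0 := sqrtr_ge0 (u ^+ 2 - 1).
have sw : Num.sqrt (u ^+ 2 - 1) <= Num.sqrt (w ^+ 2 - 1).
  by rewrite ler_wsqrtr// lerD2r lerXn2r ?nnegrE//; lra.
by rewrite /arcosh ler_ln ?posrE; lra.
Qed.

Lemma hball_cosh n (c p : hyperbolic_space R n) r : 0 <= r ->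
  hball c r p -> - lorentz (val c) (val p) < cosh r.
Proof.
move=> r0; apply: contraPT; rewrite -leNgt => H; apply/negP; rewrite -leNgt.
by rewrite -{1}(arcosh_cosh r0) ler_arcosh// cosh_ge1.
Qed.

(** A common point x would give -<p + q, x> < 2 cosh r, whereas <p + q, p + q> <= -2 - 2 cosh (2r) =
    -4 cosh^2 r forces the opposite inequality. *)
Lemma hball_disjoint n (p q : hyperbolic_space R n) r : 0 <= r ->
  cosh (2 * r) <= - lorentz (val p) (val q) -> hball p r `&` hball q r = set0.
Proof.
move=> r0 pq; apply/seteqP; split => // x [/(hball_cosh r0) px /(hball_cosh r0) qx].
have /andP[/eqP pp p0] := valP p; have /andP[/eqP qq q0] := valP q.
have C1 := cosh_ge1 r.
(* p + q points to the midpoint of p and q. *)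
suff : 2 * cosh r <= - lorentz (val p + val q) (val x) by rewrite lorentzDl; lra.
apply: lorentz_reverse_CS; first lra.
  by rewrite mxE; exact: addr_gt0.
rewrite lorentzDl !(lorentzC _ (_ + _)) !lorentzDl (lorentzC (val q) (val p)) pp qq.
by move: pq; rewrite cosh_double; lra.
Qed.

(** Geodesic polar coordinates about (1, 0, ..., 0): for a >= 0 and a unit vector v, the point at
    distance a in direction v. *)
Definition point_at n (a : R) (v : 'I_n -> R) : 'rV[R]_n.+1 :=
  \row_i cons_fun (cosh a) (fun j => sinh a * v j) i.

Lemma lorentz_point_at n (a b : R) (u v : 'I_n -> R) :
  lorentz (point_at a u) (point_at b v) =
  sinh a * sinh b * dot u v - cosh a * cosh b.
Proof.
rewrite lorentzE !mxE /cons_fun unlift_none; congr (_ - _).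
rewrite /dot mulr_sumr; apply: eq_bigr => i _.
by rewrite /space_part !mxE /cons_fun liftK; ring.
Qed.

Lemma point_at_hyperbolic n (a : R) (v : 'I_n -> R) : dot v v = 1 ->
  (lorentz (point_at a v) (point_at a v) == -1) && (0 < point_at a v 0 ord0).
Proof.
move=> v1; rewrite lorentz_point_at v1 mxE /cons_fun unlift_none.
apply/andP; split; last exact: lt_le_trans (cosh_ge1 a).
by apply/eqP; have := cosh2_sinh2 a; lra.
Qed.

Definition hpoint n (a : R) (v : 'I_n -> R) (v1 : dot v v = 1) : hyperbolic_space R n :=
  exist (fun x : 'rV[R]_n.+1 => is_true ((lorentz x x == -1) && (0 < x 0 ord0)))
    (point_at a v) (point_at_hyperbolic a v1).

Lemma lorentz_hpoint n (a b : R) (u v : 'I_n -> R) (u1 : dot u u = 1) (v1 : dot v v = 1) :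
  lorentz (val (hpoint a u1)) (val (hpoint b v1)) =
  sinh a * sinh b * dot u v - cosh a * cosh b.
Proof. exact: lorentz_point_at. Qed.

Lemma cosh0 : cosh 0 = 1 :> R.
Proof. by rewrite /cosh oppr0 expR0; field. Qed.

Lemma sinh0 : sinh 0 = 0 :> R.
Proof. by rewrite /sinh oppr0 subrr mul0r. Qed.

(* In an equilateral triangle of side 2r, an angle a satisfies
   cos a = cosh (2r) / (1 + cosh (2r)) = 1 - sech^2 r / 2. *)
Definition kissing_cos (r : R) : R := 1 - sech r ^+ 2 / 2.

Lemma kissing_cosE (r : R) : kissing_cos r = cosh (2 * r) / (1 + cosh (2 * r)).
Proof.
have := cosh_ge1 r; rewrite /kissing_cos /sech cosh_double.
move: (cosh r) => C C1; field; apply/andP; split; nra.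
Qed.

(** A spherical code with minimal angle arccos k. *)
Definition separated n (k : R) (N : nat) (v : 'I_N -> 'I_n -> R) : Prop :=
  (forall i, dot (v i) (v i) = 1) /\ (forall i j, i != j -> dot (v i) (v j) <= k).

(** By the hyperbolic law of cosines, centres at distance 2r from [o] in directions separated by the
    angle of the equilateral triangle are at least 2r apart. *)
Lemma separated_kissing n (r : R) (N : nat) (v : 'I_N -> 'I_n.+1 -> R) : 0 <= r ->
  separated (kissing_cos r) v ->
  exists (o : hyperbolic_space R n.+1) (c : 'I_N -> hyperbolic_space R n.+1),
    kissing_configuration r o c.
Proof.
move=> r0 [v1 vk].
(* At radius 0 all directions give the same point, so any unit vector can present [o]. *)
have e1 : dot (fun i : 'I_n.+1 => (i == ord0)%:R : R) (fun i => (i == ord0)%:R) = 1.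
  rewrite /dot (bigD1 ord0)//= big1 ?mulr1 ?addr0// => i /negbTE ->.
  by rewrite mulr0.
pose o := hpoint 0 e1; pose c i := hpoint (2 * r) (v1 i).
exists o, c; split=> [i|i j ij]; last first.
  apply: hball_disjoint => //; rewrite lorentz_hpoint.
  have := vk i j ij; rewrite kissing_cosE; have := cosh2_sinh2 (2 * r).
  have := cosh_ge1 (2 * r); move: (cosh _) (sinh _) (dot _ _) => D S d D1 DS.
  rewrite ler_pdivlMr => [dD|]; last lra.
  (* Expanded with S^2 = D^2 - 1, this says D^2 - S^2 d >= D, that is, the centres are at distance
     at least 2r. *)
  have : 0 <= (D - 1) * (D - d * (1 + D)) by rewrite mulr_ge0; lra.
  rewrite (_ : S * S = D ^+ 2 - 1); last by rewrite -DS; ring.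
  by lra.
split; last first.
  by apply: hball_disjoint => //; rewrite lorentz_hpoint cosh0 sinh0; lra.
(* The point of tangency is the midpoint of the two centres. *)
exists (hpoint r (v1 i)).
split; rewrite /hsphere/= /hdist -[RHS](arcosh_cosh r0) lorentz_hpoint; congr arcosh.
  by rewrite cosh0 sinh0; lra.
rewrite v1 cosh_double sinh_double; have := cosh2_sinh2 r.
move: (cosh r) (sinh r) => C S H.
transitivity (C * (2 * (C ^+ 2 - S ^+ 2) - 1)); last by rewrite H; ring.
ring.
Qed.

Lemma separated_cons n (k : R) (N : nat) (v : 'I_N -> 'I_n -> R) (x : 'I_n -> R) :
  separated k v -> dot x x = 1 -> (forall i, dot x (v i) <= k) ->
  separated k (fun i : 'I_N.+1 => if unlift ord0 i is Some j then v j else x).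
Proof.
move=> [v1 vk] x1 xk; split=> [i|i j].
  by case: unliftP => [j _|_].
case: (unliftP ord0 i) => [i' ->|->]; case: (unliftP ord0 j) => [j' ->|->] //.
- by rewrite (inj_eq lift_inj); exact: vk.
- by move=> _; rewrite dotC.
Qed.

End Hyperbolic.

(** * The lower bound from a maximal separated family *)

Theorem theorem2p4 (R : realType) (n : nat) (r : R) (hn : (2 <= n)%N)
    (hr : 0 <= r) :
  ((2 * beta ((n%:R - 1) / 2) (1 / 2) /
    incomplete_beta (sech r ^+ 2 - sech r ^+ 4 / 4)
      ((n%:R - 1) / 2) (1 / 2))%:E <= kissing_number n r)%E.
Proof.
case: n hn => [|[|n]]// _.
have -> : n.+2%:R - 1 = n.+1%:R :> R by rewrite -natr1 addrK.
have C1 := cosh_ge1 r.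
have s0 : 0 < sech r by rewrite invr_gt0; lra.
have s1 : sech r <= 1 by rewrite invf_le1; lra.
have k01 : 0 < kissing_cos r < 1.
  have : sech r ^+ 2 <= 1 by rewrite exprn_ile1// ltW.
  have : 0 < sech r ^+ 2 by rewrite exprn_gt0.
  by rewrite /kissing_cos => ? ?; apply/andP; split; lra.
have -> : sech r ^+ 2 - sech r ^+ 4 / 4 = 1 - kissing_cos r ^+ 2.
  by rewrite /kissing_cos; field.
set x := 1 - _; set b := 2 * _ / _.
(* Assuming the bound fails makes the kissing number finite, which bounds the size of separated
   families and so provides a maximal one without a compactness argument. *)
rewrite leNgt; apply/negP => lt_b.
pose P N := `[< exists v : 'I_N -> 'I_n.+2 -> R, separated (kissing_cos r) v >].
have Pb N : P N -> N%:R < b.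
  move=> /asboolP[v /(separated_kissing hr) H].
  rewrite -lte_fin; apply: (le_lt_trans _ lt_b); apply: ereal_sup_ubound.
  by exists N.
have P0 : exists N, P N.
  by exists 0%N; apply/asboolP; exists (fun=> fun=> 0); split => -[].
have Pbound N : P N -> (N <= Num.truncn b)%N.
  by move=> /Pb Nb; rewrite -ltnS -(ltr_nat R); apply: lt_trans Nb (truncnS_gt _).
have [N /asboolP[v sv] Nmax] := ex_maxnP P0 Pbound.
have := Pb N; rewrite /P => /(_ (asboolT (ex_intro _ v sv))).
apply/negP; rewrite -leNgt /b.
(* An uncovered direction could be added to the family, against maximality. *)
have cov y : dot y y = 1 -> exists i, kissing_cos r < dot y (v i).
  move=> y1; apply: contrapT => /forallNP yk.
  suff /Nmax : P N.+1 by rewrite ltnn.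
  apply/asboolP; eexists; apply: (separated_cons sv y1) => i.
  by rewrite leNgt; apply/negP; exact: yk.
have H := sphere_covering_bound k01 (proj1 sv) cov.
have := @Rintegral_ge0 _ _ R lebesgue_measure `[0, x]%classic
  (beta_weight (n.+1%:R / 2) (1 / 2)) (fun t _ => beta_weight_ge0 _ _ t).
(* If the incomplete beta value were 0, the quotient would be 0 by the convention for inverses,
   hence at most N. *)
rewrite le_eqVlt => /predU1P[I0|I0].
  by rewrite [X in _ / X](_ : _ = 0) ?invr0 ?mulr0.
by rewrite ler_pdivrMr.
Qed.
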